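(* Let $h,\tau$ be constants with $0<h<\tau$ and let $\kappa>0$ be arbitrary. Consider $$\min_{x\in\mathbb{R}}\ \tfrac12x^2-hx\quad\text{subject to}\quad x\le 0,$$ and let $\epsilon$ be a random variable taking the values $\tau$ and $-\tau$ with probability $1/2$ each. Then the unique KKT point of this problem is $(x,u)=(0,h)$. Moreover, the mean dynamics with direct sampling $$\dot x=h-x-\mathbb{E}[u+x+\epsilon]_+,\qquad \dot u=\kappa\bigl(\mathbb{E}[u+x+\epsilon]_+-u\bigr)$$ have the locally exponentially stable equilibrium $$\bar x=\frac{h-\tau}{2},\qquad \bar u=\frac{h+\tau}{2},$$ and this equilibrium violates complementarity, i.e. $\bar u\,\bar x\neq 0$.
   Context: For a scalar $t$, $[t]_+:=\max\{t,0\}$. A KKT point of the problem of minimizing $f(x)$ subject to $c(x)\le 0$, with $f(x)=\tfrac12x^2-hx$ and $c(x)=x$ on $\mathbb{R}$, is a pair $(x,u)\in\mathbb{R}\times\mathbb{R}$ with $f'(x)+u\,c'(x)=0$, $c(x)\le0$, $u\ge0$, $u\,c(x)=0$. The displayed mean dynamics are $\dot x=-f'(x)-c'(x)\mathbb{E}\widehat\lambda$, $\dot u=\kappa(\mathbb{E}\widehat\lambda-u)$, where $\widehat\lambda=[u+\widehat c]_+$ is the augmented multiplier signal (with augmentation scale $D=1$) formed directly from the noisy constraint observation $\widehat c=c(x)+\epsilon$, and the expectation is over $\epsilon$ at fixed $(x,u)$. An equilibrium is a zero of the vector field; locally exponentially stable has its standard meaning for autonomous ordinary differential equations. *)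

(* Defs.v *)
From HB Require Import structures.
From mathcomp Require Import all_boot all_order all_algebra.
From mathcomp Require Import all_classical all_reals all_analysis.

Set Implicit Arguments.
Unset Strict Implicit.
Unset Printing Implicit Defensive.

Import Order.TTheory GRing.Theory Num.Theory.
Import numFieldNormedType.Exports.

Local Open Scope classical_set_scope.
Local Open Scope ring_scope.

Definition pos_part (R : realType) (t : R) : R := Num.max t 0.

(* KKT pairs of: minimize f x subject to c x <= 0, x in R. *)
Definition KKT (R : realType) (f c : R -> R) (x u : R) : Prop :=
  [/\ derive1 f x + u * derive1 c x = 0, c x <= 0, 0 <= u & u * c x = 0].

(* E[u + c x + eps]_+ at fixed (x, u): the mean of the augmented multiplier
   signal, with augmentation scale 1, formed from the noisy observation
   c x + eps of the constraint. *)
Definition mean_signal d (T : measurableType d) (R : realType)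
    (P : probability T R) (c : R -> R) (eps : T -> R) (x u : R) : R :=
  fine 'E_P[fun w => pos_part (u + (c x + eps w))].

(* Points of the state space are pairs (x, u). *)
Definition mean_field d (T : measurableType d) (R : realType)
    (P : probability T R) (f c : R -> R) (eps : T -> R) (kappa : R)
    (p : R * R) : R * R :=
  let lam := mean_signal P c eps p.1 p.2 in
  (- derive1 f p.1 - derive1 c p.1 * lam, kappa * (lam - p.2)).

Section autonomous_ode.
Variables (R : realType) (V : normedModType R).
Implicit Types (F : V -> V) (z : R -> V) (S : \bar R).

Definition equilibrium F (p : V) : Prop := F p = 0.

(* The interval [0, S[, where S = +oo is allowed. *)
Definition forward_interval S : set R := [set t | 0 <= t /\ (t%:E < S)%E].

(* z' = F z on [0, S[. The limit of the difference quotient is taken inside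
   [0, S[, so the derivative is one-sided at 0 and nothing is required of z
   outside [0, S[. *)
Definition ode_solution F S z : Prop :=
  forall t, forward_interval S t ->
    (s - t)^-1 *: (z s - z t) @[s --> within (forward_interval S) t^']
      --> F (z t).

(* Every nearby initial state has a global forward solution, and every forward
   solution, whatever its interval of definition, obeys one uniform
   exponential bound. *)
Definition locally_exponentially_stable F (p : V) : Prop :=
  exists delta M alpha : R,
    [/\ 0 < delta, 0 < M, 0 < alpha &
      forall z0 : V, `|z0 - p| < delta ->
        (exists2 z, ode_solution F +oo%E z & z 0 = z0) /\
        (forall S z, ode_solution F S z -> z 0 = z0 ->
          forall t, forward_interval S t ->
            `|z t - p| <= M * expR (- alpha * t) * `|z0 - p|)].

End autonomous_ode.

(* Main.v *)
Require Import Defs.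
From HB Require Import structures.
From mathcomp Require Import all_boot all_order all_algebra.
From mathcomp Require Import all_classical all_reals all_analysis.
From mathcomp Require Import measurable_realfun ring lra.

Set Implicit Arguments.
Unset Strict Implicit.
Unset Printing Implicit Defensive.

Import Order.TTheory GRing.Theory Num.Theory.
Import numFieldNormedType.Exports.

Local Open Scope classical_set_scope.
Local Open Scope ring_scope.

(** The whole argument rests on one quadratic function.  Write the state as
    (x, u), let m s be the mean of [s + eps]_+, that is, the average of
    [s + tau]_+ and [s - tau]_+ ([expectation_two_point]), and set
    y = x - xbar, v = u - ubar, D = m (u + x) - m h.  Since xbar + ubar = h and
    m h = ubar, the dynamics read y' = - y - D, v' = kappa (D - v), and for the
    energy E = kappa y^2 + v^2 one finds
      E' = - 2 kappa (y^2 + v^2 - (v - y) D).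
    As m is 1-Lipschitz, |D| <= |v + y|, so (v - y) D <= |v^2 - y^2| and E never
    increases, wherever the state is ([energy_dissipation]).

    A solution that starts close to the equilibrium therefore stays close to
    it for as long as it exists, with no continuation argument.  Close to the
    equilibrium |u + x| <= tau, where m s = (s + tau) / 2 and the dynamics are
    affine; there E' = - 3 kappa y^2 - kappa v^2 <= - min (3, kappa) E
    ([energy_dissipation_affine]), which gives the exponential bound
    ([direct_field_stable]).

    Global existence comes from the same estimate.  The affine system has
    explicit solutions for all times ([linear_planar_solution]); its signal
    (s + tau) / 2 is 1-Lipschitz too, so its solutions that start close
    enough never leave the region where the two vector fields agree, and they
    are solutions of the mean dynamics as well. *)

(** * Difference quotients on a forward interval *)

Lemma near_dnbhs_shift (R : realType) (t : R) (Q : R -> Prop) :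
  (\forall s \near t^', Q (s - t)) <-> (\forall h \near 0^', Q h).
Proof.
split.
- move=> /nbhs_ballP [e /= e0 He]; apply/nbhs_ballP; exists e => //= s.
  rewrite /ball /= => se s0.
  have := He (s + t); rewrite /ball /= addrK; apply.
    by rewrite (_ : t - (s + t) = 0 - s) //; ring.
  by apply: contra_neq s0 => ?; apply: (addIr t); rewrite add0r.
- move=> /nbhs_ballP [e /= e0 He]; apply/nbhs_ballP; exists e => //= s.
  rewrite /ball /= => se s0; apply: He; last by rewrite subr_eq0.
  by rewrite /ball /= (_ : 0 - (s - t) = t - s) //; ring.
Qed.

(** A derivative is a limit over increments h -> 0, a solution is given by slopes
    as s -> t; this lemma passes from one form to the other. *)
Lemma is_derive_slopeP (R : realType) (f : R -> R) (t l : R) :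
  is_derive t 1 f l <->
  (s - t)^-1 * (f s - f t) @[s --> t^'] --> l.
Proof.
have E : (s - t)^-1 * (f s - f t) @[s --> t^'] --> l <->
    h^-1 *: (f (h *: (1 : R) + t) - f t) @[h --> 0^'] --> l.
  split=> /cvgrPdist_lt H; apply/cvgrPdist_lt => e /H {}H.
    apply/(near_dnbhs_shift t); apply: filterS H => s.
    by rewrite /= /GRing.scale /= mulr1 subrK.
  move/(near_dnbhs_shift t) : H; apply: filterS => s.
  by rewrite /= /GRing.scale /= mulr1 subrK.
rewrite E; split=> [[df <-]|H]; first exact: df.
have df : derivable f t 1 by apply/cvg_ex; exists l.
by apply: DeriveDef => //; exact: (cvg_lim _ H).
Qed.

Lemma forward_interval_nbhs (R : realType) (S : \bar R) (t : R) :
  0 < t -> forward_interval S t -> nbhs t (forward_interval S).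
Proof.
move=> t0 [_ tS]; case: S tS => [S| |] //= tS.
- near=> s; split; first by apply: ltW; near: s; exact: lt_nbhsr.
  by rewrite lte_fin; near: s; apply: lt_nbhsl; rewrite -lte_fin.
- near=> s; split; first by apply: ltW; near: s; exact: lt_nbhsr.
  by rewrite ltry.
Unshelve. all: by end_near. Qed.

Lemma forward_interval_right (R : realType) (S : \bar R) (t : R) :
  0 < t -> forward_interval S t ->
  \forall s \near (0 : R)^'+, forward_interval S s.
Proof.
move=> t0 [_ tS]; near=> s; split; first by [].
by apply: le_lt_trans tS; rewrite lee_fin; near: s; exact: nbhs_right_le.
Unshelve. all: by end_near. Qed.

Section slopes.
Variables (R : realType) (S : \bar R) (f : R -> R) (l : R).

(** Away from 0 a forward interval is a neighbourhood of its points, so the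
    relative derivative is the usual one and the mean value theorem applies. *)
Lemma is_derive_of_slope (t : R) : 0 < t -> forward_interval S t ->
  (s - t)^-1 * (f s - f t) @[s --> within (forward_interval S) t^'] --> l ->
  is_derive t 1 f l.
Proof.
move=> t0 tS H; apply/is_derive_slopeP.
apply: cvg_trans H; apply: cvg_app => B HB.
have tA : t^' (forward_interval S) by exact/nbhs_dnbhs/forward_interval_nbhs.
have {}HB : \forall s \near t^', forward_interval S s -> B s by exact: HB.
by apply: filter_app tA.
Qed.

Lemma slope_of_is_derive (t : R) : is_derive t 1 f l ->
  (s - t)^-1 * (f s - f t) @[s --> within (forward_interval S) t^'] --> l.
Proof. by move/is_derive_slopeP; exact: cvg_within_filter. Qed.

(** At 0 only a one-sided slope is available.  All that is needed there is
    continuity from the right, and t witnesses that the interval is more than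
    the point 0. *)
Lemma cvg_right_of_slope (t : R) : 0 < t -> forward_interval S t ->
  (s - 0)^-1 * (f s - f 0) @[s --> within (forward_interval S) 0^'] --> l ->
  f @ 0^'+ --> f 0.
Proof.
move=> t0 tS H.
have {}H : (s - 0)^-1 * (f s - f 0) @[s --> 0^'+] --> l.
  apply: cvg_trans H; apply: cvg_app => B HB.
  have tA := forward_interval_right t0 tS.
  apply: filter_app tA.
  have : \forall s \near nbhs (0 : R), s != 0 -> forward_interval S s -> B s.
    exact: HB.
  by apply: filterS => s H s0; apply: H; rewrite gt_eqF.
have H0 : (fun s : R => s) @ 0^'+ --> (0 : R).
  exact: (@cvg_within_filter _ _ _ (nbhs (0 : R))).
have lim : f 0 + s * ((s - 0)^-1 * (f s - f 0)) @[s --> 0^'+] --> f 0.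
  rewrite -[X in _ --> X]addr0 -[X in _ + X](mul0r l).
  by apply: cvgD (cvg_cst _) _; exact: cvgM H0 H.
apply: cvg_trans lim; apply: near_eq_cvg.
near=> s => /=.
have s0 : s != 0 by rewrite gt_eqF //.
by rewrite subr0 mulrA mulfV // mul1r addrC subrK.
Unshelve. all: by end_near. Qed.

End slopes.

(** * Exponential decay from a differential inequality *)

Lemma is_derive_expR_linear (R : realType) (k t : R) :
  is_derive t 1 (fun x => expR (k * x)) (k * expR (k * t)).
Proof.
have ? : is_derive t 1 ( *%R k) k.
  by apply: is_derive_eq; rewrite /GRing.scale /= mulr1.
have D := is_derive1_comp (f := expR) (g := *%R k) (x := t).
by apply: is_derive_eq; rewrite mulrC.
Qed.

(** The function exp (a t) phi t has nonpositive derivative.  Right continuity at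
    0 is assumed only for nondegenerate intervals: for the others it could not
    be obtained from a solution. *)
Lemma exponential_decay (R : realType) (S : \bar R) (phi dphi : R -> R) (a : R) :
  (forall t, 0 < t -> forward_interval S t -> is_derive t 1 phi (dphi t)) ->
  (forall t, 0 < t -> forward_interval S t -> dphi t <= - a * phi t) ->
  (forall t, 0 < t -> forward_interval S t -> phi @ 0^'+ --> phi 0) ->
  forall t, forward_interval S t -> phi t <= expR (- a * t) * phi 0.
Proof.
move=> D le cr t tS; have := tS.1; rewrite le_eqVlt => /predU1P[<-|t0].
  by rewrite mulr0 expR0 mul1r.
have IS s : 0 < s -> s <= t -> forward_interval S s.
  move=> s0 st; split; first exact: ltW.
  by apply: le_lt_trans tS.2; rewrite lee_fin.
pose psi s := expR (a * s) * phi s.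
have Dpsi s : 0 < s -> s <= t ->
    is_derive s 1 psi (expR (a * s) * (a * phi s + dphi s)).
  move=> s0 st; have ? := D s s0 (IS s s0 st).
  have ? := is_derive_expR_linear a s.
  apply: is_derive_eq; rewrite /GRing.scale /=; ring.
have cpsi s : 0 < s -> s <= t -> {for s, continuous psi}.
  move=> s0 st; apply/differentiable_continuous/derivable1_diffP.
  by case: (Dpsi s s0 st).
have : psi t <= psi 0.
  apply: (@ler0_derive1_le_cc _ psi 0 t); rewrite ?in_itv /= ?lexx ?ltW //.
  - by move=> s /[!in_itv]/= /andP[s0 st]; case: (Dpsi s s0 (ltW st)).
  - move=> s /[!in_itv]/= /andP[s0 st]; have [_] := Dpsi s s0 (ltW st).
    rewrite derive1E => ->; rewrite pmulr_rle0 ?expR_gt0 //.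
    have := le s s0 (IS s s0 (ltW st)); lra.
  - apply/continuous_within_itvP => //; split.
    + by move=> s /[!in_itv]/= /andP[s0 st]; exact: cpsi (ltW st).
    + apply: cvgM; last exact: cr tS.
      apply: (@cvg_within_filter _ _ _ (nbhs (0:R))).
      apply: continuous_comp; last exact: continuous_expR.
      by apply: mulrl_continuous.
    + by apply: (@cvg_within_filter _ _ _ (nbhs t)); exact: cpsi.
rewrite /psi mulr0 expR0 mul1r mulNr expRN => H.
by rewrite mulrC ler_pdivlMr ?expR_gt0 // mulrC.
Qed.

(** * Explicit solutions of planar linear systems *)

(** D is the solution of D'' = delta D with D 0 = 0 and D' 0 = 1, and C = D': these
    are hyperbolic, trigonometric or affine functions according to the sign of
    delta. *)
Lemma oscillator_basis (R : realType) (delta : R) :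
  exists C D : R -> R, [/\ C 0 = 1, D 0 = 0 &
    forall t : R, is_derive t 1 D (C t) /\ is_derive t 1 C (delta * D t)].
Proof.
have Dlin (k t : R) : is_derive t 1 ( *%R k) k.
  by apply: is_derive_eq; rewrite /GRing.scale /= mulr1.
have [d0|d0|->] := ltrgt0P delta.
- pose w := Num.sqrt delta.
  have w0 : w != 0 by rewrite gt_eqF // sqrtr_gt0.
  have ww : delta = w * w by rewrite -expr2 sqr_sqrtr // ltW.
  exists (fun t => (expR (w * t) + expR (- w * t)) / 2),
         (fun t => (expR (w * t) - expR (- w * t)) / (2 * w)).
  split; first by rewrite !mulr0 expR0; field.
    by rewrite !mulr0 expR0 subrr mul0r.
  move=> t.
  have ? := is_derive_expR_linear w t.
  have ? := is_derive_expR_linear (- w) t.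
  split; apply: is_derive_eq; rewrite /GRing.scale /= ?ww; field => //.
- pose w := Num.sqrt (- delta).
  have w0 : w != 0 by rewrite gt_eqF // sqrtr_gt0 oppr_gt0.
  have ww : delta = - (w * w).
    by rewrite -expr2 sqr_sqrtr ?opprK // oppr_ge0 ltW.
  exists (fun t => cos (w * t)), (fun t => sin (w * t) / w).
  split; first by rewrite mulr0 cos0.
    by rewrite mulr0 sin0 mul0r.
  move=> t.
  have ? : is_derive t 1 (fun x => sin (w * x)) (w * cos (w * t)).
    have D := is_derive1_comp (f := sin) (g := *%R w) (x := t).
    apply: is_derive_eq.
    by rewrite mulrC.
  have Dc : is_derive t 1 (fun x => cos (w * x)) (- w * sin (w * t)).
    have D := is_derive1_comp (f := cos) (g := *%R w) (x := t).
    apply: is_derive_eq.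
    by rewrite mulrC mulrN mulNr.
  split; apply: is_derive_eq; rewrite /GRing.scale /= ?ww; field => //.
- exists (fun=> 1), id; split => // t; split; first exact: is_derive_id.
  by rewrite mul0r; exact: is_derive_cst.
Qed.

(** Removing half the trace leaves a matrix A with entries p, b, c, - p, and
    A^2 = (p^2 + b c) I by Cayley-Hamilton.  Hence exp (t A) = C t I + D t A with C
    and D as in [oscillator_basis], whether the eigenvalues are real, equal or
    complex. *)
Lemma linear_planar_solution (R : realType) (a b c d y0 v0 : R) :
  exists y v : R -> R, [/\ y 0 = y0, v 0 = v0 &
    forall t : R, is_derive t 1 y (a * y t + b * v t) /\
              is_derive t 1 v (c * y t + d * v t)].
Proof.
pose m := (a + d) / 2; pose p := (a - d) / 2.
have [C [D [C0 D0 H]]] := oscillator_basis (p * p + b * c).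
exists (fun t => expR (m * t) * (C t * y0 + D t * (p * y0 + b * v0))),
       (fun t => expR (m * t) * (C t * v0 + D t * (c * y0 - p * v0))).
rewrite !mulr0 expR0 C0 D0; split; [ring|ring|move=> t].
have [DD DC] := H t.
have ? := is_derive_expR_linear m t.
by split; apply: is_derive_eq; rewrite /GRing.scale /= /m /p; field.
Qed.

(** * The mean signal for noise with two values *)

Definition mean_two_point (R : realType) (tau s : R) : R :=
  (pos_part (s + tau) + pos_part (s - tau)) / 2.

(** Nothing is known of eps off the two level sets, but these carry the whole
    mass, so the integral reduces to them. *)
Lemma expectation_two_point (R : realType) (d : measure_display)
  (T : measurableType d) (P : probability T R) (eps : {RV P >-> R})
  (a b : R) (g : R -> R) :
  a != b -> measurable_fun setT g -> (forall x, 0 <= g x) ->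
  P (eps @^-1` [set a]) = (2^-1)%:E -> P (eps @^-1` [set b]) = (2^-1)%:E ->
  fine 'E_P[fun w => g (eps w)] = (g a + g b) / 2.
Proof.
move=> ab mg g0 Pa Pb; rewrite unlock.
set A := eps @^-1` [set a] in Pa; set B := eps @^-1` [set b] in Pb.
have mA : measurable A by rewrite -[A]setTI; exact: measurable_funPT.
have mB : measurable B by rewrite -[B]setTI; exact: measurable_funPT.
have AB : A `&` B = set0.
  by apply/seteqP; split => // w [/= ea eb]; move/eqP: ab; apply; rewrite -ea -eb.
have PAB : P (A `|` B) = 1%E.
  rewrite measureU //. transitivity ((2^-1 : R)%:E + (2^-1)%:E)%E.
    exact: (congr2 adde Pa Pb).
  by rewrite -EFinD; congr EFin; field.
have mAB : measurable (A `|` B) by exact: measurableU.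
have PABC : P (~` (A `|` B)) = 0%E.
  by have := probability_setC P mAB; rewrite [X in (1 - X)%E](_ : _ = 1%E) ?subee.
have mge : measurable_fun setT (fun w => (g (eps w))%:E).
  by apply/measurable_EFinP; apply: measurableT_comp.
have const (r : R) : P (eps @^-1` [set r]) = (2^-1)%:E ->
    (\int[P]_(w in eps @^-1` [set r]) (g (eps w))%:E = (g r / 2)%:E)%E.
  move=> Pr; rewrite (eq_integral (cst (g r)%:E)).
    rewrite integral_cst; first by rewrite EFinM; exact: (congr1 (mule _) Pr).
    by rewrite -[X in measurable X]setTI; exact: measurable_funPT.
  by move=> w /[!inE] /= ->.
rewrite (@ge0_negligible_integral _ _ _ P setT (~` (A `|` B))) //.
2: exact: measurableC.
2: by move=> w _; rewrite lee_fin.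
rewrite setTD setCK ge0_integral_setU //; first last.
- by rewrite disj_set2E AB.
- by move=> w _; rewrite lee_fin.
- exact: measurable_funTS.
by rewrite !const // -EFinD /= mulrDl.
Qed.

Lemma pos_part_ge0 (R : realType) (t : R) : 0 <= pos_part t.
Proof. by rewrite /pos_part le_max lexx orbT. Qed.

Lemma pos_part_lipschitz (R : realType) (s t : R) :
  `|pos_part s - pos_part t| <= `|s - t|.
Proof.
rewrite /pos_part; case: (ltrP s 0) => s0; case: (ltrP t 0) => t0.
- by rewrite subrr normr0.
- by rewrite (@ltr0_norm _ (s - t)) ?ler_norml; lra.
- by rewrite (@ger0_norm _ (s - t)) ?ler_norml; lra.
- by [].
Qed.

Lemma mean_two_point_lipschitz (R : realType) (tau s t : R) :
  `|mean_two_point tau s - mean_two_point tau t| <= `|s - t|.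
Proof.
have := pos_part_lipschitz (s + tau) (t + tau).
have := pos_part_lipschitz (s - tau) (t - tau).
rewrite (_ : s - tau - (t - tau) = s - t); last by ring.
rewrite (_ : s + tau - (t + tau) = s - t); last by ring.
rewrite /mean_two_point !ler_norml; lra.
Qed.

(** The noise straddles the kink: s + tau lies on its active side and s - tau on
    the inactive one, which gives the slope 1/2. *)
Lemma mean_two_point_affine (R : realType) (tau s : R) :
  `|s| <= tau -> mean_two_point tau s = (s + tau) / 2.
Proof.
rewrite ler_norml => st; rewrite /mean_two_point /pos_part.
by rewrite max_l ?max_r; lra.
Qed.

(** * Energy estimates along planar solutions *)

Section planar_ode.
Variables (R : realType) (F : R * R -> R * R) (S : \bar R) (z : R -> R * R).

Lemma ode_solution_coordP :
  ode_solution F S z <-> forall t, forward_interval S t ->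
    (s - t)^-1 * ((z s).1 - (z t).1) @[s --> within (forward_interval S) t^']
      --> (F (z t)).1 /\
    (s - t)^-1 * ((z s).2 - (z t).2) @[s --> within (forward_interval S) t^']
      --> (F (z t)).2.
Proof.
split=> H t tS.
- have {}H := H t tS; split.
  + exact: (cvg_comp _ _ H (@cvg_fst _ _ _ _ _)).
  + exact: (cvg_comp _ _ H (@cvg_snd _ _ _ _ _)).
- have [H1 H2] := H t tS.
  rewrite [X in _ --> X]surjective_pairing.
  exact: (cvg_pair H1 H2).
Qed.

Lemma ode_solution_of_derive :
  (forall t, forward_interval S t ->
    is_derive t 1 (fun s => (z s).1) (F (z t)).1 /\
    is_derive t 1 (fun s => (z s).2) (F (z t)).2) ->
  ode_solution F S z.
Proof.
move=> H; apply/ode_solution_coordP => t tS; have [D1 D2] := H t tS.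
by split; exact: slope_of_is_derive.
Qed.

Definition energy (k : R) (q : R * R) : R := k * q.1 ^+ 2 + q.2 ^+ 2.

(** The left-hand side of the hypothesis is the derivative of the energy along
    the solution. *)
Lemma energy_decay (k a : R) (p : R * R) :
  ode_solution F S z ->
  (forall t, forward_interval S t ->
     2 * (k * (z t - p).1 * (F (z t)).1 + (z t - p).2 * (F (z t)).2)
       <= - a * energy k (z t - p)) ->
  forall t, forward_interval S t ->
    energy k (z t - p) <= expR (- a * t) * energy k (z 0 - p).
Proof.
move=> /ode_solution_coordP sol le.
apply: (exponential_decay (phi := fun t => energy k (z t - p))
  (dphi := fun t => 2 * (k * (z t - p).1 * (F (z t)).1
                         + (z t - p).2 * (F (z t)).2))).
- move=> t t0 tS; have [H1 H2] := sol t tS.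
  have ? := is_derive_of_slope t0 tS H1.
  have ? := is_derive_of_slope t0 tS H2.
  rewrite /energy /=; apply: is_derive_eq; rewrite /GRing.scale /=; ring.
- by move=> t _; exact: le.
- move=> t t0 tS.
  have S0 : forward_interval S 0.
    by split => //; apply: le_lt_trans tS.2; rewrite lee_fin ltW.
  have [H1 H2] := sol 0 S0.
  have c1 := cvg_right_of_slope t0 tS H1.
  have c2 := cvg_right_of_slope t0 tS H2.
  rewrite /energy /=; apply: cvgD.
  + apply: cvgM; first exact: cvg_cst.
    by rewrite !expr2; apply: cvgM; apply: cvgB => //; exact: cvg_cst.
  + by rewrite !expr2; apply: cvgM; apply: cvgB => //; exact: cvg_cst.
Qed.

End planar_ode.

Lemma prod_norm_le (R : realType) (q : R * R) (e : R) :
  (`|q| <= e) = (`|q.1| <= e) && (`|q.2| <= e).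
Proof. by rewrite prod_normE ge_max. Qed.

(** The norm on pairs is the maximum norm, so the energy lies between
    min (1, k) |q|^2 and (k + 1) |q|^2.  The factor 1 + k + k^-1 is chosen to
    avoid both the minimum and square roots: its square is at least k + 1 and at
    least (k + 1) / k. *)
Lemma norm_le_of_energy (R : realType) (k r : R) (q q0 : R * R) :
  0 < k -> 0 <= r -> energy k q <= r ^+ 2 * energy k q0 ->
  `|q| <= (1 + k + k^-1) * r * `|q0|.
Proof.
move=> k0 r0; set M := 1 + k + k^-1 => H.
set N := `|q0|.
have N0 : 0 <= N by exact: normr_ge0.
have /andP[n1 n2] : (`|q0.1| <= N) && (`|q0.2| <= N) by rewrite -prod_norm_le.
have sq (x : R) : `|x| <= N -> x ^+ 2 <= N ^+ 2.
  move=> xN; rewrite -[x ^+ 2]ger0_norm ?sqr_ge0 //.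
  by rewrite normrX lerXn2r ?nnegrE.
have kV0 : 0 < k^-1 by rewrite invr_gt0.
have E : energy k q <= (k + 1) * (r * N) ^+ 2.
  apply: (le_trans H); rewrite /energy.
  rewrite (_ : _ * (r * N) ^+ 2 = r ^+ 2 * ((k + 1) * N ^+ 2)); last by ring.
  rewrite ler_wpM2l ?sqr_ge0 //.
  by rewrite mulrDl mul1r lerD ?sq // ler_wpM2l ?sq // ltW.
have rN : 0 <= (r * N) ^+ 2 by exact: sqr_ge0.
have root (x : R) : x ^+ 2 <= M ^+ 2 * (r * N) ^+ 2 -> `|x| <= M * r * N.
  have M0 : 0 <= M by rewrite /M; lra.
  move=> xM; rewrite -(@ler_pXn2r _ 2) ?nnegrE //; last by rewrite !mulr_ge0.
  by rewrite -normrX ger0_norm ?sqr_ge0 // -mulrA exprMn.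
have q1 := sqr_ge0 q.1; have q2 := sqr_ge0 q.2.
rewrite /energy in E.
have M1 : (k + 1) <= M ^+ 2 by rewrite /M; nra.
have M2 : k^-1 * (k + 1) <= M ^+ 2.
  rewrite mulrDr mulVf ?gt_eqF // /M; nra.
rewrite prod_norm_le; apply/andP; split; apply: root.
- apply: le_trans (ler_wpM2r rN M2); rewrite -mulrA ler_pdivlMl //.
  by apply: le_trans E; rewrite lerDl.
- apply: le_trans (ler_wpM2r rN M1).
  by apply: le_trans E; rewrite lerDr mulr_ge0 // ltW.
Qed.

(** * Stability of the direct-sampling dynamics *)

Section direct_sampling_field.
Variables (R : realType) (h tau kappa : R).
Hypotheses (h_gt0 : 0 < h) (h_lt_tau : h < tau) (kappa_gt0 : 0 < kappa).

Definition direct_field (m : R -> R) (q : R * R) : R * R :=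
  (h - q.1 - m (q.2 + q.1), kappa * (m (q.2 + q.1) - q.2)).

Definition direct_equilibrium : R * R := ((h - tau) / 2, (h + tau) / 2).

Let affine (s : R) := (s + tau) / 2.
Let p := direct_equilibrium.
Let M := 1 + kappa + kappa^-1.
Let alpha := Num.min 3 kappa / 2.

(** The weight kappa on the first coordinate makes the quadratic cross terms
    cancel for an affine m; for a nonlinear one, a Lipschitz constant at most 1
    leaves a remainder that the damping - y^2 - v^2 absorbs. *)
Lemma energy_dissipation (m : R -> R) (q : R * R) :
  (forall s t, `|m s - m t| <= `|s - t|) -> m h = affine h ->
  2 * (kappa * (q - p).1 * (direct_field m q).1
       + (q - p).2 * (direct_field m q).2)
    <= 0.
Proof.
move=> lip mh; case: q => x u /=.
set y := x - _; set v := u - _.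
have := lip (u + x) h; rewrite mh.
set D := m _ - affine h => HD.
have xE : h - x - m (u + x) = - y - D by rewrite /y /D /affine /=; field.
have uE : m (u + x) - u = D - v by rewrite /v /D /affine /=; field.
rewrite xE uE.
have vy : u + x - h = v + y by rewrite /v /y /=; field.
rewrite vy in HD.
(* |D| <= |v + y| turns the product into a difference of squares *)
have key : (v - y) * D <= v ^+ 2 + y ^+ 2.
  apply: (le_trans (ler_norm _)); rewrite normrM.
  apply: (le_trans (ler_wpM2l (normr_ge0 _) HD)); rewrite -normrM -subr_sqr.
  by rewrite (le_trans (ler_normB _ _)) // !ger0_norm // sqr_ge0.
have -> : 2 * (kappa * y * (- y - D) + v * (kappa * (D - v))) =
    - (2 * kappa * (v ^+ 2 + y ^+ 2 - (v - y) * D)) by ring.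
by rewrite oppr_le0 mulr_ge0 ?subr_ge0 // mulr_ge0 // ltW.
Qed.

Lemma energy_dissipation_affine (q : R * R) :
  2 * (kappa * (q - p).1 * (direct_field affine q).1
       + (q - p).2 * (direct_field affine q).2)
    <= - (2 * alpha) * energy kappa (q - p).
Proof.
case: q => x u; rewrite /energy /=; set y := x - _; set v := u - _.
have -> : h - x - affine (u + x) = - (3 / 2) * y - v / 2.
  by rewrite /y /v /affine /=; field.
have -> : affine (u + x) - u = (y - v) / 2 by rewrite /y /v /affine /=; field.
have a3 : 2 * alpha <= 3 by rewrite /alpha mulrC divfK // ge_min lexx.
have ak : 2 * alpha <= kappa by rewrite /alpha mulrC divfK // ge_min lexx orbT.
rewrite -subr_ge0.
have -> : - (2 * alpha) * (kappa * y ^+ 2 + v ^+ 2)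
   - 2 * (kappa * y * (- (3 / 2) * y - v / 2) + v * (kappa * ((y - v) / 2)))
  = kappa * (3 - 2 * alpha) * y ^+ 2 + (kappa - 2 * alpha) * v ^+ 2 by field.
by rewrite addr_ge0 // mulr_ge0 ?sqr_ge0 ?subr_ge0 // mulr_ge0 ?subr_ge0 // ltW.
Qed.

(** Energy monotonicity confines the solution to the ball of radius (tau - h) / 2
    about the equilibrium, and u + x varies there by at most tau - h around h.
    This serves both the field itself and its affine model. *)
Lemma direct_solution_in_affine_region (m : R -> R) (S : \bar R)
  (z : R -> R * R) :
  (forall s t, `|m s - m t| <= `|s - t|) -> m h = affine h ->
  ode_solution (direct_field m) S z ->
  `|z 0 - p| < (tau - h) / (2 * M) ->
  forall t, forward_interval S t -> `|(z t).2 + (z t).1| <= tau.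
Proof.
move=> lip mh sol z0 t tS.
have M0 : 0 < M by rewrite !addr_gt0 ?invr_gt0.
have E : energy kappa (z t - p) <= 1 ^+ 2 * energy kappa (z 0 - p).
  have := energy_decay (k := kappa) (a := 0) (p := p) sol _ tS.
  rewrite oppr0 mul0r expR0 expr1n; apply => s sS.
  by rewrite mul0r; exact: energy_dissipation.
have := norm_le_of_energy kappa_gt0 ler01 E; rewrite -/M mulr1 => le.
have : `|z t - p| <= (tau - h) / 2.
  apply: (le_trans le); rewrite mulrC -ler_pdivlMr //.
  by apply: (le_trans (ltW z0)); rewrite invfM mulrA.
have near_eq (x u : R) : `|x - (h - tau) / 2| <= (tau - h) / 2 ->
    `|u - (h + tau) / 2| <= (tau - h) / 2 -> `|u + x| <= tau.
  have := h_gt0; rewrite !ler_norml; lra.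
by rewrite prod_norm_le => /andP[] /near_eq; exact.
Qed.

(** The matrix of the affine field in the coordinates centred at its equilibrium
    has rows (- 3/2, - 1/2) and (kappa/2, - kappa/2). *)
Lemma affine_global_solution (z0 : R * R) :
  exists2 z, ode_solution (direct_field affine) +oo%E z & z 0 = z0.
Proof.
have [y [v [y0 v0 D]]] := linear_planar_solution (- (3 / 2)) (- 2^-1)
  (kappa / 2) (- (kappa / 2)) (z0 - p).1 (z0 - p).2.
exists (fun t => (p.1 + y t, p.2 + v t)); last first.
  rewrite y0 v0 -[(z0 - p).1]/(z0.1 - p.1) -[(z0 - p).2]/(z0.2 - p.2).
  by rewrite !(addrC _ (_ - _)) !subrK -surjective_pairing.
apply: ode_solution_of_derive => t _ /=; have [Dy Dv] := D t.
by split; apply: is_derive_eq; rewrite /affine /=; field.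
Qed.

Lemma direct_field_stable (m : R -> R) :
  (forall s t, `|m s - m t| <= `|s - t|) ->
  (forall s, `|s| <= tau -> m s = affine s) ->
  locally_exponentially_stable (direct_field m) p.
Proof.
move=> lip maff.
have M0 : 0 < M by rewrite !addr_gt0 ?invr_gt0.
have mh : m h = affine h.
  by apply: maff; rewrite ger0_norm ltW.
have field_affine q : `|q.2 + q.1| <= tau ->
    direct_field m q = direct_field affine q.
  by move=> H; rewrite /direct_field maff.
exists ((tau - h) / (2 * M)), M, alpha; split => //.
- by rewrite divr_gt0 ?subr_gt0 // mulr_gt0.
- by rewrite divr_gt0 // lt_min kappa_gt0 andbT.
move=> z0 z0p; split.
- have [z sol zz0] := affine_global_solution z0.
  exists z => // t tS; rewrite field_affine; first exact: sol.
  apply: direct_solution_in_affine_region sol _ _ tS => //; last by rewrite zz0.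
  move=> s s'; rewrite /affine -mulrBl.
  rewrite (_ : s + tau - (s' + tau) = s - s'); last by ring.
  by rewrite normrM (@ger0_norm _ 2^-1) // ler_piMr // invf_le1 // ler1n.
- move=> S z sol zz0 t tS.
  have E : energy kappa (z t - p) <=
      expR (- alpha * t) ^+ 2 * energy kappa (z 0 - p).
    rewrite -expRM_natl mulrA mulrN.
    apply: (energy_decay sol) tS => s sS; rewrite field_affine.
      exact: energy_dissipation_affine.
    by apply: direct_solution_in_affine_region sol _ _ sS => //; rewrite zz0.
  by rewrite -zz0; exact: norm_le_of_energy kappa_gt0 (expR_ge0 _) E.
Qed.

End direct_sampling_field.

(** * The optimization problem and its mean dynamics *)

Lemma derive1_objective (R : realType) (h x : R) :
  derive1 (fun x : R => 2^-1 * x ^+ 2 - h * x) x = x - h.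
Proof.
rewrite derive1E; apply: derive_val.
by apply: is_derive_eq; rewrite /GRing.scale /=; field.
Qed.

Lemma derive1_constraint (R : realType) (x : R) : derive1 (fun x : R => x) x = 1.
Proof. by rewrite derive1E; exact: derive_id. Qed.

Lemma measurable_pos_part_shift (R : realType) (s : R) :
  measurable_fun setT (fun e : R => pos_part (s + e)).
Proof.
apply: measurable_maxr; last exact: measurable_cst.
by apply: measurable_funD; [exact: measurable_cst|exact: measurable_id].
Qed.

Theorem proposition4p3 (R : realType) (h tau kappa : R)
  (h_gt0 : 0 < h) (h_lt_tau : h < tau) (kappa_gt0 : 0 < kappa)
  (d : measure_display) (T : measurableType d) (P : probability T R)
  (eps : {RV P >-> R})
  (eps_pos : P (eps @^-1` [set tau]) = (2^-1)%:E)
  (eps_neg : P (eps @^-1` [set - tau]) = (2^-1)%:E) :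
  let f := fun x : R => 2^-1 * x ^+ 2 - h * x in
  let c := fun x : R => x in
  let F := mean_field P f c eps kappa in
  let xbar := (h - tau) / 2 in
  let ubar := (h + tau) / 2 in
  [/\ (forall x u : R, KKT f c x u <-> (x, u) = (0, h)),
      (forall x u : R,
         let m := fine 'E_P[fun w => pos_part (u + x + eps w)] in
         F (x, u) = (h - x - m, kappa * (m - u))),
      equilibrium F (xbar, ubar),
      locally_exponentially_stable F (xbar, ubar) &
      ubar * xbar != 0].
Proof.
move=> f c F xbar ubar.
have signalE x u : mean_signal P c eps x u = mean_two_point tau (u + x).
  rewrite /mean_signal /mean_two_point /c.
  rewrite -(@expectation_two_point _ _ _ _ eps tau (- tau)
    (fun e => pos_part (u + x + e))) //.
  - by congr (fine 'E_P[_]); apply/funext => w; rewrite addrA.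
  - by rewrite gt_eqF //; lra.
  - exact: measurable_pos_part_shift.
  - by move=> e; exact: pos_part_ge0.
have FE : F = direct_field h kappa (mean_two_point tau).
  apply/funext => -[x u]; rewrite /F /mean_field /direct_field /= signalE.
  by rewrite derive1_objective derive1_constraint mul1r opprB.
have near_h s : `|s| <= tau -> mean_two_point tau s = (s + tau) / 2.
  exact: mean_two_point_affine.
split.
- move=> x u; rewrite /KKT derive1_objective derive1_constraint /c mulr1; split.
  + move=> [stat x0 u0 /eqP]; rewrite mulf_eq0 => /orP[] /eqP E.
      (* u = 0 would force x = h > 0, which is infeasible *)
      by exfalso; move: stat x0; rewrite E; lra.
    by rewrite E; congr pair; lra.
  + by case=> -> ->; split; lra.
- move=> x u m; rewrite FE /direct_field /= -signalE.
  rewrite (_ : mean_signal P c eps x u = m) //.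
  by congr (fine 'E_P[_]); apply/funext => w; rewrite addrA.
- rewrite /equilibrium FE /direct_field /= near_h.
    by congr pair; rewrite /xbar /ubar; field.
  by rewrite ger0_norm /xbar /ubar; lra.
- rewrite FE; apply: direct_field_stable => //.
  exact: mean_two_point_lipschitz.
- by rewrite mulf_neq0 // /ubar /xbar; [rewrite gt_eqF | rewrite lt_eqF] => //; lra.
Qed.
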